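(* Let $G$ be a twin-free graph on $n$ vertices. Then $LD(G) \leq \lceil \frac{5n}{8} \rceil$.
   Context: All graphs are finite and simple. Two distinct vertices $v,v'$ of a graph $G$ are twins if $N_G(v)\setminus\{v'\}=N_G(v')\setminus\{v\}$ (i.e. their open or closed neighbourhoods coincide); $G$ is twin-free if it has no pair of twins. For $X\subseteq V(G)$, $X$ distinguishes two vertices $v,v'\notin X$ if $N_G(v)\cap X\neq N_G(v')\cap X$. A set $X\subseteq V(G)$ is a locating set if every pair of distinct vertices of $V(G)\setminus X$ is distinguished by $X$. A set $X$ is dominating if every vertex of $V(G)\setminus X$ has a neighbour in $X$. A locating-dominating set is a set that is both locating and dominating, and $LD(G)$ denotes the minimum size of a locating-dominating set of $G$. *)

(* Defs.v *)
From mathcomp Require Import all_boot.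
Set Implicit Arguments. Unset Strict Implicit. Unset Printing Implicit Defensive.

Definition simple_graph (T : finType) (e : rel T) : Prop :=
  symmetric e /\ irreflexive e.

Definition nbhd (T : finType) (e : rel T) (v : T) : {set T} := [set u | e v u].

Definition twins (T : finType) (e : rel T) (v v' : T) : Prop :=
  v != v' /\ nbhd e v :\ v' = nbhd e v' :\ v.

Definition twin_free (T : finType) (e : rel T) : Prop :=
  forall v v' : T, ~ twins e v v'.

Definition distinguishes (T : finType) (e : rel T) (X : {set T}) (v v' : T) : bool :=
  (v \notin X) && (v' \notin X) && (nbhd e v :&: X != nbhd e v' :&: X).

Definition locating (T : finType) (e : rel T) (X : {set T}) : bool :=
  [forall v, forall v', ((v \notin X) && (v' \notin X) && (v != v')) ==>
                         distinguishes e X v v'].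

Definition dominating (T : finType) (e : rel T) (X : {set T}) : bool :=
  [forall v, (v \notin X) ==> (nbhd e v :&: X != set0)].

Definition locating_dominating (T : finType) (e : rel T) (X : {set T}) : bool :=
  locating e X && dominating e X.

(* LD(G): minimum size of a locating-dominating set (V(G) itself is one,
   so #|T| is a valid initial value for the minimum). *)
Definition LD (T : finType) (e : rel T) : nat :=
  \big[minn/#|T|]_(X : {set T} | locating_dominating e X) #|X|.

(* Main.v *)
Require Import Defs.
From mathcomp Require Import all_boot.
From mathcomp Require Import perm.
From mathcomp Require Import zify.

(** For a set X of vertices, the pattern of a vertex outside X is its neighbourhood in X, and
    k(X) is the number of patterns.  Call Y separated if the complement of Y is locating; one
    representative per pattern of X forms a separated set, so we look for a separated set with
    more than 3n/8 vertices.  Take X of maximal size with k(X) >= |X|; the interesting case is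
    k(X) = |X| = w.  By maximality a vertex of C, the union of the m nonsingleton classes,
    splits no class, and a vertex alone in its class splits at most one.  Hence C is separated,
    and n = 2w + |C| - m.  A third separated set Y is found by fixing D in Y, with D obtained
    from C by removing one or two vertices per class, putting fewer than |D| vertices that
    distinguish D (Bondy) in the complement, and repeating the maximality argument on the other
    vertices, a third of which can be put in Y.  This gives 3|Y| >= n + |C| - 2m + 1, hence
    |C| + 3|Y| + 4w >= 3n + 1 and one of the three sets has more than 3n/8 vertices.

    The vertices removed from C must be chosen so that every pair is still distinguished outside
    D.  The critical pairs are a, b with b in X and a alone in its class, distinguished only by
    vertices of one class p ([link]).  Exchanging a and b moves these vertices from the class p
    to the class of the pattern p with the bit b flipped.  If X also maximizes the number of
    nonsingleton classes, no sequence of such moves can create a new one. *)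

Set Implicit Arguments. Unset Strict Implicit. Unset Printing Implicit Defensive.

(* [lia] preprocesses every boolean hypothesis; only the cardinal (in)equalities matter here. *)
Ltac card_lia :=
  repeat match goal with
  | H : is_true (leq _ _) |- _ => revert H
  | H : @eq nat _ _ |- _ => revert H
  end; clear; intros; lia.

(** * Patterns and separated sets *)

Section Patterns.
Variables (T : finType) (e : rel T).
Hypothesis esym : symmetric e.
Implicit Types (Z X Y D B P p q : {set T}) (a b u v x y z : T).

Definition dst a b := [set z | [&& z != a, z != b & e z a != e z b]].
Definition pat (Z : {set T}) v := [set x in Z | e v x].
Definition cl (Z p : {set T}) := [set v | (v \notin Z) && (pat Z v == p)].
(** [rich 0 Z] is the set of patterns that occur, so k(Z) is its size; [rich 1 Z] is the set of
    patterns of nonsingleton classes. *)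
Definition rich j (Z : {set T}) := [set p | j < #|cl Z p|].
Definition splits v Z :=
  [set p | [exists u1 in cl Z p :\ v, exists u2 in cl Z p :\ v, e v u1 && ~~ e v u2]].
Definition sep (Y : {set T}) :=
  forall u v, u \in Y -> v \in Y -> u != v -> exists2 z, z \notin Y & e z u != e z v.

Lemma mem_cl Z v : v \notin Z -> v \in cl Z (pat Z v).
Proof. by move=> vZ; rewrite inE vZ eqxx. Qed.

Lemma clP Z p v : reflect (v \notin Z /\ pat Z v = p) (v \in cl Z p).
Proof. by rewrite inE; apply: (iffP andP) => -[-> /eqP ?]; split=> //; apply/eqP. Qed.

Lemma rich0E Z : rich 0 Z = pat Z @: ~: Z.
Proof.
apply/setP=> p; rewrite inE card_gt0; apply/set0Pn/imsetP => -[v].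
  by case/clP=> vZ <-; exists v; rewrite // inE.
by rewrite inE => vZ ->; exists v; rewrite mem_cl.
Qed.

Lemma patP Z u v : reflect (forall x, x \in Z -> e u x = e v x) (pat Z u == pat Z v).
Proof.
apply: (iffP eqP) => [/setP E x xZ|E]; first by have := E x; rewrite !inE xZ.
by apply/setP=> x; rewrite !inE; case: (boolP (x \in Z)) => //= /E.
Qed.

Lemma pat_neq Z u v : pat Z u != pat Z v -> exists2 x, x \in Z & e u x != e v x.
Proof.
move=> /patP N; case: (pickP (fun x => (x \in Z) && (e u x != e v x))) => [x /andP[] *|H].
  by exists x.
by case: N => x xZ; move: (H x); rewrite xZ => /negbFE/eqP.
Qed.

Lemma sep_pat (Z Y : {set T}) : Y \subset ~: Z -> {in Y &, injective (pat Z)} -> sep Y.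
Proof.
move=> YZ inj u v uY vY /eqP uv.
have /pat_neq [x xZ xN] : pat Z u != pat Z v by apply/eqP => /inj; auto.
exists x; last by rewrite ![e x _]esym.
by apply/negP => /(subsetP YZ); rewrite inE xZ.
Qed.

Lemma transversal_sep (Z : {set T}) : exists2 Y, sep Y & #|Y| = #|rich 0 Z|.
Proof.
pose f p := [pick v in cl Z p]; pose Y := [set v | (v \notin Z) && (f (pat Z v) == Some v)].
have inj : {in Y &, injective (pat Z)}.
  by move=> u v; rewrite !inE => /andP[_ /eqP U] /andP[_ /eqP V] E; move: V; rewrite -E U => -[].
exists Y; first by apply: sep_pat inj; apply/subsetP=> v; rewrite !inE => /andP[].
rewrite -(card_in_imset inj); apply: eq_card => p; rewrite inE card_gt0.
apply/imsetP/set0Pn => [[v]|[v vp]]; first by rewrite inE => /andP[vZ _] ->; exists v; rewrite mem_cl.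
rewrite -/(mem _) /=; case E : (f p) => [w|]; last first.
  by move: E; rewrite /f; case: pickP => // /(_ v); rewrite vp.
have wp : w \in cl Z p by move: E; rewrite /f; case: pickP => // x xp [<-].
by case/clP: (wp) => wZ wE; exists w; rewrite // inE wZ wE E eqxx.
Qed.

Lemma patU1 Z v u : pat (v |: Z) u = (if e u v then [set v] else set0) :|: pat Z u.
Proof.
apply/setP=> x; rewrite !inE; case: eqVneq => [->|N].
  by case: (e u v); rewrite !inE ?eqxx ?andbF.
by case: (e u v); rewrite !inE ?(negPf N).
Qed.

(* Adding [v] to [Z] loses at most the class of [v] and gains one class for each class split by [v]. *)
Lemma card_rich_add v (Z : {set T}) : v \notin Z ->
  #|rich 0 Z| + #|splits v Z| <= #|rich 0 (v |: Z)| + (#|cl Z (pat Z v)| <= 1).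
Proof.
move=> vZ.
(* [A0] and [A1] are the patterns on Z of the non-neighbours and of the neighbours of v. With v
   added, those in [A1] gain v, so at least |A0| + |A1| patterns occur. Split classes lie in the
   intersection, and only the pattern of v can be missing from the union. *)
pose A0 := pat Z @: [set u | (u \notin v |: Z) && ~~ e u v].
pose A1 := pat Z @: [set u | (u \notin v |: Z) && e u v].
have vA p : p \in A0 :|: A1 -> v \notin p.
  by rewrite in_setU => /orP[] /imsetP[u _ ->]; rewrite inE (negPf vZ).
have AA : #|A0| + #|A1| <= #|rich 0 (v |: Z)|.
  have inj : {in A1 &, injective (fun p => v |: p)}.
    move=> p q pA qA E; have vp : v \notin p by apply: vA; rewrite inE pA orbT.
    have vq : v \notin q by apply: vA; rewrite inE qA orbT.
    by rewrite -(setU1K vp) E setU1K.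
  rewrite -(card_in_imset inj) -cardsUI; set I := _ :&: _.
  have -> : I = set0.
    apply/setP=> p; rewrite !inE; apply/negP => /andP[pA /imsetP[q qA E]].
    have /negP[] : v \notin p by apply: vA; rewrite inE pA.
    by rewrite E setU11.
  rewrite cards0 addn0 rich0E; apply: subset_leq_card; apply/subsetP => p.
  rewrite inE => /orP[] /imsetP[].
    move=> u; rewrite inE => /andP[uZ /negPf uv] ->; apply/imsetP; exists u; first by rewrite inE.
    by rewrite patU1 uv set0U.
  move=> q /imsetP[u]; rewrite inE => /andP[uZ uv] -> ->.
  by apply/imsetP; exists u; [rewrite inE|rewrite patU1 uv].
have AI : #|splits v Z| <= #|A0 :&: A1|.
  apply: subset_leq_card; apply/subsetP=> p; rewrite inE.
  case/exists_inP=> u1 /setD1P[u1v /clP[u1Z u1p]] /exists_inP[u2 /setD1P[u2v /clP[u2Z u2p]]] /andP[s1 s2].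
  rewrite inE; apply/andP; split; apply/imsetP.
    by exists u2; rewrite // !inE negb_or u2v u2Z esym.
  by exists u1; rewrite // !inE negb_or u1v u1Z esym.
have AU : #|rich 0 Z| <= #|A0 :|: A1| + (#|cl Z (pat Z v)| <= 1).
  have AUu u : u \notin Z -> u != v -> pat Z u \in A0 :|: A1.
    move=> uZ uv; rewrite inE; case: (boolP (e u v)) => euv.
      by apply/orP; right; apply/imsetP; exists u; rewrite // !inE negb_or uv uZ.
    by apply/orP; left; apply/imsetP; exists u; rewrite // !inE negb_or uv uZ.
  case: (leqP #|cl Z (pat Z v)| 1) => [_|/card_gt1P[x [y [xv yv xy]]]].
    apply: leq_trans (_ : #|pat Z v |: (A0 :|: A1)| <= _); last by rewrite cardsU1 addnC leq_add2l leq_b1.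
    apply: subset_leq_card; apply/subsetP=> p; rewrite rich0E => /imsetP[u]; rewrite inE => uZ ->.
    by rewrite inE in_set1; case: (eqVneq u v) => [->|uv]; rewrite ?eqxx // AUu ?orbT.
  rewrite addn0; apply: subset_leq_card; apply/subsetP=> p; rewrite rich0E => /imsetP[u]; rewrite inE => uZ ->.
  case: (eqVneq u v) => [->|uv]; last exact: AUu.
  case/clP: xv => xZ <-; case/clP: yv => yZ E.
  case: (eqVneq x v) => [xv|]; last exact: AUu.
  by rewrite xv -E; apply: AUu; rewrite // eq_sym -xv.
move: (cardsUI A0 A1); card_lia.
Qed.

Lemma mem_splits v (Z p : {set T}) u1 u2 :
  u1 \in cl Z p -> u2 \in cl Z p -> u1 != v -> u2 != v -> e v u1 != e v u2 -> p \in splits v Z.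
Proof.
wlog E1 : u1 u2 / e v u1 => [H|] c1 c2 n1 n2 N.
  case E : (e v u1); first exact: (H u1 u2).
  by apply: (H u2 u1); rewrite // 1?eq_sym //; move: N; rewrite E; case: (e v u2).
have E2 : ~~ e v u2 by move: N; rewrite E1; case: (e v u2).
rewrite inE; apply/exists_inP; exists u1; first by rewrite in_setD1 n1.
by apply/exists_inP; exists u2; rewrite ?E1 // in_setD1 n2.
Qed.

Lemma nonsingle_no_split v Z p u1 u2 : v \notin Z ->
  #|rich 0 (v |: Z)| <= #|rich 0 Z| -> 1 < #|cl Z (pat Z v)| ->
  u1 \in cl Z p -> u2 \in cl Z p -> u1 != v -> u2 != v -> e v u1 = e v u2.
Proof.
move=> vZ le g1 c1 c2 n1 n2; apply/eqP; apply: contraT => N.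
have := card_rich_add vZ; rewrite [_ <= 1]leqNgt g1 addn0.
have : 0 < #|splits v Z| by apply/card_gt0P; exists p; exact: mem_splits N.
card_lia.
Qed.

Lemma split_unique v Z p q u1 u2 w1 w2 : v \notin Z ->
  #|rich 0 (v |: Z)| <= #|rich 0 Z| ->
  u1 \in cl Z p -> u2 \in cl Z p -> u1 != v -> u2 != v -> e v u1 != e v u2 ->
  w1 \in cl Z q -> w2 \in cl Z q -> w1 != v -> w2 != v -> e v w1 != e v w2 -> p = q.
Proof.
move=> vZ le c1 c2 n1 n2 N d1 d2 m1 m2 M; apply/eqP; apply: contraT => pq.
have : 1 < #|splits v Z|.
  by apply/card_gt1P; exists p, q; rewrite (mem_splits c1 c2) ?(mem_splits d1 d2).
move: (card_rich_add vZ) le; case: (#|cl Z (pat Z v)| <= 1) => /=; card_lia.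
Qed.

Lemma pat_subset Z Z' u v : Z \subset Z' -> pat Z' u = pat Z' v -> pat Z u = pat Z v.
Proof.
move=> ZZ' /eqP/patP E; apply/eqP/patP => x xZ; apply: E; exact: (subsetP ZZ').
Qed.

(** Take Z maximal with Z containing B, disjoint from D and |Z| + |D| <= k(Z) + |B|. If this is
    strict, all classes are singletons and the complement of Z serves. Otherwise let [S1] be the
    vertices outside D that are alone in their class. As k(Z) >= |S1| + |D|, the transversal Y1 and
    Y2 = [~: Z :\: S1] satisfy 2|Y1| + |Y2| + |B| >= n + 2|D|. The last hypothesis makes Y2
    separated: a vertex outside D that splits a class of Z lies in [S1]. *)
Lemma relative_sep B D : [disjoint B & D] -> {in D &, injective (pat B)} ->
  (forall a b, a \notin B -> b \notin B -> a != b -> exists2 z, z \notin D & z \in dst a b) ->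
  exists2 Y, sep Y & #|T| + 2 * #|D| <= 3 * #|Y| + #|B|.
Proof.
move=> dBD injD H.
pose good Z := [&& B \subset Z, [disjoint Z & D] & #|Z| + #|D| <= #|rich 0 Z| + #|B|].
have DB v : v \in D -> v \notin B by move=> vD; apply: contraL vD => vB; rewrite (disjointFr dBD vB).
have gB : good B.
  rewrite /good subxx dBD addnC leq_add2r -(card_in_imset injD) rich0E subset_leq_card //.
  by apply: imsetS; apply/subsetP=> v /DB; rewrite inE.
case: (arg_maxnP (fun Z => #|Z|) gB) => Z /and3P[BZ dZD kZ] Zmax.
have DZ v : v \in D -> v \notin Z by move=> vD; apply: contraL vD => vB; rewrite (disjointFr dZD vB).
have add v : v \notin Z -> v \notin D -> #|rich 0 (v |: Z)| + #|B| <= #|Z| + #|D|.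
  move=> vZ vD; rewrite leqNgt; apply/negP => N.
  have : good (v |: Z).
    rewrite /good (subset_trans BZ (subsetU1 _ _)) cardsU1 vZ -addnA add1n N andbT /=.
    by rewrite disjoints_subset subUset sub1set inE vD -disjoints_subset.
  by move/Zmax; rewrite /= cardsU1 vZ ltnn.
have injDZ : {in D &, injective (pat Z)}.
  by move=> u v uD vD /(pat_subset BZ); apply: injD.
have cDZ : #|D| <= #|~: Z|.
  by apply: subset_leq_card; apply/subsetP=> v /DZ; rewrite inE.
have cZ := cardsC Z.
have cB : #|B| <= #|Z| by apply: subset_leq_card.
case: (ltnP (#|Z| + #|D|) (#|rich 0 Z| + #|B|)) => kZ1.
  have single v : v \notin Z -> v \notin D -> #|cl Z (pat Z v)| <= 1.
    move=> vZ vD; have := add v vZ vD; have := card_rich_add vZ.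
    by case: (_ <= 1) => //; card_lia.
  have inj : {in ~: Z &, injective (pat Z)}.
    move=> u v; rewrite !inE => uZ vZ E; apply/eqP; apply: contraT => uv.
    have g1 : 1 < #|cl Z (pat Z u)|.
      by apply/card_gt1P; exists u, v; rewrite mem_cl // E mem_cl.
    case: (boolP (u \in D)) => uD; last by move: (single u uZ uD); card_lia.
    case: (boolP (v \in D)) => vD; last by move: (single v vZ vD); rewrite -E; card_lia.
    by move: uv; rewrite (injDZ u v uD vD E) eqxx.
  exists (~: Z); first exact: sep_pat inj.
  by move: kZ1; rewrite rich0E card_in_imset //; card_lia.
pose S1 := [set v in ~: Z | (v \notin D) && (#|cl Z (pat Z v)| <= 1)].
have S1Z v : v \in S1 -> v \notin Z by rewrite !inE => /andP[].
have cS1 : #|S1| + #|D| <= #|rich 0 Z|.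
  have -> : #|S1| + #|D| = #|S1 :|: D|.
    rewrite -cardsUI; have -> : S1 :&: D = set0; last by rewrite cards0 addn0.
    by apply/setP=> v; rewrite !inE; case: (v \in D); rewrite ?andbF.
  have inj : {in S1 :|: D &, injective (pat Z)}.
    have aux u v : u \in S1 -> v \notin Z -> pat Z u = pat Z v -> u = v.
      rewrite !inE => /and3P[uZ _ c] vZ E; apply/eqP; apply: contraT => uv.
      have : 1 < #|cl Z (pat Z u)|; last by card_lia.
      by apply/card_gt1P; exists u, v; rewrite mem_cl // E mem_cl.
    move=> u v /setUP[uS|uD] /setUP[vS|vD] E.
    - by apply: aux => //; apply: S1Z.
    - by apply: aux => //; apply: DZ.
    - by symmetry; apply: aux => //; apply: DZ.
    - exact: injDZ.
  rewrite -(card_in_imset inj) rich0E; apply/subset_leq_card/imsetS/subsetP => v.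
  by rewrite in_setC => /setUP[/S1Z|/DZ].
have [Y1 sY1 cY1] := transversal_sep Z.
have sY2 : sep (~: Z :\: S1).
  move=> u v; rewrite !in_setD !in_setC => /andP[uS uZ] /andP[vS vZ] uv.
  case: (eqVneq (pat Z u) (pat Z v)) => [E|/pat_neq[x xZ N]]; last first.
    by exists x; rewrite ?inE ?xZ ?andbF // ![e x _]esym.
  have nB w : w \notin Z -> w \notin B by apply: contra; apply: (subsetP BZ).
  have [z zD] := H u v (nB u uZ) (nB v vZ) uv.
  rewrite inE => /and3P[zu zv N]; exists z => //.
  have zZ : z \notin Z.
    by apply: contra N => zZ; move/eqP/patP: E => /(_ z zZ); rewrite ![e _ z]esym => ->.
  rewrite in_setD negb_and negbK; apply/orP; left; rewrite inE in_setC zZ zD leqNgt /=.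
  apply: contra N => g1; apply/eqP; apply: (@nonsingle_no_split z Z (pat Z u)) => //.
  - by have := add z zZ zD; card_lia.
  - exact: mem_cl.
  - by rewrite E mem_cl.
  - by rewrite eq_sym.
  - by rewrite eq_sym.
have cY2 : #|~: Z :\: S1| + #|S1| = #|~: Z|.
  rewrite -(cardsID S1 (~: Z)) addnC (setIidPr _) //.
  by apply/subsetP => v /S1Z; rewrite inE.
case: (leqP #|~: Z :\: S1| #|Y1|) => cmp; [exists Y1|exists (~: Z :\: S1)] => //; card_lia.
Qed.

(* A Bondy-type argument: each vertex added to [P] increases the number of patterns on [D]. *)
Lemma grow_patterns D W P0 : #|P0| < #|pat P0 @: D| ->
  exists P, [/\ P0 \subset P, P \subset P0 :|: W, #|P| < #|pat P @: D| &
    forall u v w, u \in D -> v \in D -> pat P u = pat P v -> w \in W -> e u w = e v w].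
Proof.
move=> k0; pose good P := [&& P0 \subset P, P \subset P0 :|: W & #|P| < #|pat P @: D|].
have g0 : good P0 by rewrite /good subxx subsetUl.
case: (arg_maxnP (fun P => #|P|) g0) => P /and3P[P0P PW kP] Pmax.
exists P; split=> // u v w uD vD E wW; apply/eqP; apply: contraT => N.
have wP : w \notin P by apply: contra N => wP; move/eqP/patP: E => ->.
have : good (w |: P).
  rewrite /good (subset_trans P0P (subsetU1 _ _)) cardsU1 wP add1n /=.
  have -> /= : w |: P \subset P0 :|: W by rewrite subUset sub1set inE wW orbT.
  apply: leq_ltn_trans kP _; have -> : pat P @: D = (fun p => p :&: P) @: (pat (w |: P) @: D).
    rewrite -imset_comp; apply: eq_imset => x; apply/setP => y; rewrite !inE.
    by case: (y \in P); rewrite ?orbT ?andbT ?andbF.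
  rewrite ltn_neqAle leq_imset_card andbT.
  apply/negP => /imset_injP inj; move/negP: N; apply; apply/eqP.
  have /setP/(_ w) : pat (w |: P) u = pat (w |: P) v.
    apply: inj; rewrite ?imset_f //; move: E => /setP E; apply/setP => y.
    by move: (E y); rewrite !inE; case: (y \in P); rewrite ?orbT ?andbT ?andbF.
  by rewrite !inE eqxx.
by move/Pmax; rewrite /= cardsU1 wP ltnn.
Qed.
End Patterns.

(** * Exchanging two vertices *)

Section Swap.
Variable T : finType.
Implicit Types (e : rel T) (Z X Y D P p q : {set T}) (a b u v x y z : T).

Definition flip b p := if b \in p then p :\ b else b |: p.

Lemma mem_flip b p x : (x \in flip b p) = (x \in p) (+) (x == b).
Proof.
rewrite /flip; case: (boolP (b \in p)) => bp; rewrite !inE;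
by case: eqVneq => [->|_]; rewrite ?(negPf bp) ?bp ?addbF.
Qed.

Lemma flip_neq b p : flip b p != p.
Proof.
by apply/eqP => /setP/(_ b); rewrite mem_flip eqxx; case: (b \in p).
Qed.

(* [a] and [b] look alike except to a nonempty proper part of the class [p]; after exchanging them
   this part has the pattern [flip b p], and all other patterns are unchanged. *)
Definition link e X a b p :=
  [&& a \notin X, #|cl e X (pat e X a)| <= 1, b \in X, dst e a b != set0,
      dst e a b \subset cl e X p & cl e X p :\: dst e a b != set0].

(** Maximal size, no surplus of patterns, and the tie-break on nonsingleton classes. Only
    cardinalities enter, so the condition can be compared between isomorphic graphs. *)
Definition opt e X :=
  [/\ forall Z, #|X| < #|Z| -> #|rich e 0 Z| < #|Z|,
      forall Z, #|Z| = #|X| -> #|rich e 0 Z| <= #|X|,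
      #|rich e 0 X| = #|X| &
      forall Z, #|Z| = #|X| -> #|rich e 0 Z| = #|X| -> #|rich e 1 Z| <= #|rich e 1 X|].

(** Instead of exchanging a and b in X, the graph is relabelled and X stays fixed, so patterns keep
    their names. *)
Definition swap e a b : rel T := fun u v => e (tperm a b u) (tperm a b v).

Lemma swap_sym e a b : symmetric e -> symmetric (swap e a b).
Proof. by move=> es u v; apply: es. Qed.

Lemma card_rich_swap e a b j Z :
  #|rich (swap e a b) j Z| = #|rich e j (tperm a b @: Z)|.
Proof.
set s := tperm a b; have si : injective s := perm_inj.
have patE v : pat e (s @: Z) (s v) = s @: pat (swap e a b) Z v.
  by apply/setP=> x; rewrite -(permKV s x) !mem_imset // !inE mem_imset.
have clE p : cl e (s @: Z) (s @: p) = s @: cl (swap e a b) Z p.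
  apply/setP=> w; rewrite -(permKV s w) mem_imset // !inE mem_imset // patE.
  by congr andb; apply/eqP/eqP => [/(imset_inj si)|->].
rewrite -(card_imset _ (imset_inj si)); apply: eq_card => q; rewrite inE.
have -> : q = s @: (s^-1%g @: q).
  by rewrite -imset_comp -[LHS]imset_id; apply: eq_imset => x; rewrite /= permKV.
by rewrite (mem_imset _ _ (imset_inj si)) inE clE card_imset.
Qed.

Lemma link_gt1 e X a b p : link e X a b p -> 1 < #|cl e X p|.
Proof.
case/and5P=> _ _ _ /set0Pn[z zd] /andP[/subsetP dp /set0Pn[w /setDP[wp wd]]].
by apply/card_gt1P; exists z, w; rewrite dp // wp; split=> //; apply: contraNneq wd => <-.
Qed.

Lemma pat_mem e X p u x : u \in cl e X p -> x \in X -> e u x = (x \in p).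
Proof. by case/clP=> _ <- xX; rewrite inE xX. Qed.

Lemma single_neq e X a p u : #|cl e X (pat e X a)| <= 1 -> a \notin X -> 1 < #|cl e X p| ->
  u \in cl e X p -> u != a.
Proof. by move=> c aX g /clP[_ E]; apply: contraTneq g => ua; rewrite -E ua -leqNgt. Qed.

Lemma dst_eq e a b z : z != a -> z != b -> z \notin dst e a b -> e z a = e z b.
Proof. by rewrite inE => -> -> /=; rewrite negbK => /eqP. Qed.

Lemma cl_notin e X p u : u \in cl e X p -> u \notin X.
Proof. by case/clP. Qed.

(** If a and a1 differ, both being alone in their classes, some x in X distinguishes them. Both
    agree with b on X minus b, so x = b; but the edge between a and a1 forces them to agree at b
    too. *)
Lemma link_label e X a a1 b p q : symmetric e ->
  link e X a b p -> link e X a1 b q -> a = a1 /\ p = q.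
Proof.
move=> es L1 L2; have g1 := link_gt1 L1; have g2 := link_gt1 L2.
case/and5P: L1 => aX sa bX /set0Pn[z zd] /andP[/subsetP dp _].
case/and5P: L2 => a1X sa1 _ _ /andP[/subsetP dq _].
have E : a = a1.
  apply/eqP; apply: contraT => N.
  have na : a \notin dst e a1 b by apply/negP=> /dq/(single_neq sa aX g2); rewrite eqxx.
  have na1 : a1 \notin dst e a b by apply/negP=> /dp/(single_neq sa1 a1X g1); rewrite eqxx.
  have ab : a != b by apply: contraNneq aX => ->.
  have a1b : a1 != b by apply: contraNneq a1X => ->.
  have [x xX xN] : exists2 x, x \in X & e a x != e a1 x.
    apply: pat_neq; apply/eqP => E; move: sa; rewrite leqNgt => /negP[].
    by apply/card_gt1P; exists a, a1; rewrite mem_cl // E mem_cl.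
  have xa : x != a by apply: contraNneq aX => <-.
  have xa1 : x != a1 by apply: contraNneq a1X => <-.
  case: (eqVneq x b) => [xb|xb]; last first.
    have nx1 : x \notin dst e a b by apply/negP=> /dp/cl_notin; rewrite xX.
    have nx2 : x \notin dst e a1 b by apply/negP=> /dq/cl_notin; rewrite xX.
    by move: xN; rewrite ![e _ x]es (dst_eq xa xb nx1) (dst_eq xa1 xb nx2) eqxx.
  move: xN; rewrite xb -(dst_eq N ab na) -(dst_eq _ a1b na1) 1?eq_sym //.
  by rewrite es eqxx.
split=> //; subst a1; have := dp z zd; have := dq z zd.
by move=> /clP[_ <-] /clP[_ <-].
Qed.

(** If p and q differ, a agrees with b on the class q, and b and b1, being in X, are uniform on it.
    Then a and b1 are distinguished by all of q or by none of it. *)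
Lemma link_fst e X a b b1 p q : link e X a b p -> link e X a b1 q -> p = q.
Proof.
move=> L1 L2; have g2 := link_gt1 L2.
case/and5P: L1 => aX sa bX _ /andP[/subsetP dp _].
case/and5P: L2 => _ _ b1X /set0Pn[z zd] /andP[/subsetP dq /set0Pn[w /setDP[wq wd]]].
apply/eqP; apply: contraT => pq.
have U u : u \in cl e X q -> [/\ (u != a) && (u != b), u != b1, e u b = (b \in q), e u b1 = (b1 \in q) & u \notin dst e a b].
  move=> uq; have uX := cl_notin uq; split.
  - by rewrite (single_neq sa aX g2 uq); apply: contraNneq uX => ->.
  - by apply: contraNneq uX => ->.
  - exact: pat_mem uq bX.
  - exact: pat_mem uq b1X.
  - by apply: contra pq => /dp/clP[_ <-]; case/clP: uq => _ ->.
have [/andP[wa wb] wb1 Ewb Ewb1 wN] := U w wq.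
have [/andP[za zb] zb1 Ezb Ezb1 zN] := U z (dq z zd).
move: zd; rewrite inE za zb1 (dst_eq za zb zN) Ezb Ezb1.
by rewrite -Ewb -(dst_eq wa wb wN) -Ewb1 (dst_eq wa wb1 wd) eqxx.
Qed.

(** * The effect of one exchange *)

Section OneSwap.
Variables (e : rel T) (X : {set T}) (a b : T) (p : {set T}).
Hypotheses (es : symmetric e) (lk : link e X a b p).
Let e' := swap e a b.
Let d := dst e a b.

Lemma pat_swap u : u \notin X -> pat e' X u = if u \in d then flip b p else pat e X u.
Proof.
move=> uX; case/and5P: (lk) => aX sa bX _ /andP[/subsetP dp _].
have ub : u != b by apply: contraNneq uX => ->.
have E y : y \in X -> e' u y = e u y (+) ((u \in d) && (y == b)).
  move=> yX; have ya : y != a by apply: contraNneq aX => <-.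
  rewrite /e' /swap; case: (eqVneq u a) => [->|ua].
    rewrite tpermL; have -> /= : a \in d = false by rewrite inE eqxx.
    case: (eqVneq y b) => [->|yb]; first by rewrite tpermR es addbF.
    rewrite tpermD 1?eq_sym // addbF ![e _ y]es (@dst_eq e a b) //.
    by apply/negP => /dp/cl_notin; rewrite yX.
  rewrite [tperm a b u]tpermD 1?eq_sym //.
  case: (eqVneq y b) => [->|yb]; last by rewrite tpermD 1?eq_sym // andbF addbF.
  rewrite tpermR inE ua ub /= andbT.
  by case: (e u a) (e u b) => [] [].
apply/setP=> y; case: (boolP (u \in d)) => ud; last first.
  by rewrite !inE; case: (boolP (y \in X)) => //= /E; rewrite (negPf ud) addbF.
case/clP: (dp u ud) => _ <-; rewrite mem_flip !inE.
case: (boolP (y \in X)) => yX /=; first by rewrite E // ud.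
by case: eqVneq => // yb; rewrite yb bX in yX.
Qed.

Lemma mem_cl_swap u q :
  (u \in cl e' X q) = if u \in d then q == flip b p else u \in cl e X q.
Proof.
case/and5P: (lk) => aX sa bX _ /andP[/subsetP dp _].
case: (boolP (u \in X)) => uX; last first.
  by rewrite ![u \in cl _ _ _]inE uX pat_swap //=; case: (u \in d) => //; rewrite eq_sym.
rewrite ![u \in cl _ _ _]inE uX /=; case: (boolP (u \in d)) => // /dp/cl_notin.
by rewrite uX.
Qed.

Lemma cl_swap_sub q : q != p -> cl e X q \subset cl e' X q.
Proof.
move=> qp; case/and5P: (lk) => aX sa bX _ /andP[/subsetP dp _].
apply/subsetP=> u uq; rewrite mem_cl_swap; case: (boolP (u \in d)) => // /dp/clP[_ E].
by case/negP: qp; case/clP: uq => _ <-; rewrite E.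
Qed.

Lemma cl_swap_eq q : q != p -> q != flip b p -> cl e' X q = cl e X q.
Proof.
move=> qp qf; apply/setP=> u; apply/idP/idP; last exact: (subsetP (cl_swap_sub qp)).
by rewrite mem_cl_swap (negPf qf); case: (u \in d).
Qed.

Lemma cl_swap_p : cl e' X p = cl e X p :\: d.
Proof.
apply/setP=> u; rewrite mem_cl_swap in_setD eq_sym (negPf (flip_neq b p)).
by case: (u \in d).
Qed.

Lemma dst_sub_swap : d \subset cl e' X (flip b p).
Proof. by apply/subsetP=> u ud; rewrite mem_cl_swap ud eqxx. Qed.

Hypothesis strong : 1 < #|cl e X p :\: d|.

(** After the exchange all old patterns survive and [flip b p] occurs; as k cannot exceed |X|,
    [flip b p] occurred before. It now has an old and a moved vertex, while p stays nonsingleton by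
    [strong], so maximality of the number of nonsingleton classes makes [flip b p] nonsingleton from
    the start. *)
Lemma opt_swap : opt e X -> opt e' X /\ 1 < #|cl e X (flip b p)|.
Proof.
case=> O1 O1' O2 O3; case/and5P: (lk) => aX sa bX dn /andP[/subsetP dp _].
have tI := @perm_inj _ (tperm a b).
have ct Z : #|tperm a b @: Z| = #|Z| by rewrite card_imset.
have sub0 : flip b p |: rich e 0 X \subset rich e' 0 X.
  apply/subsetP=> q /setU1P[->|]; rewrite !inE.
    by apply: leq_trans (subset_leq_card dst_sub_swap); rewrite card_gt0.
  case: (eqVneq q p) => [->|qp] g; first by rewrite cl_swap_p; card_lia.
  by apply: leq_trans g _; rewrite subset_leq_card // cl_swap_sub.
have le0 : #|rich e' 0 X| <= #|X| by rewrite card_rich_swap O1' ?ct.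
have f0 : flip b p \in rich e 0 X.
  apply: contraT => N; have := subset_leq_card sub0.
  by rewrite cardsU1 N O2 add1n ltnNge le0.
have eq0 : #|rich e' 0 X| = #|X|.
  apply/eqP; rewrite eqn_leq le0 -O2 subset_leq_card //.
  by apply: subset_trans sub0; apply: subsetU1.
have sub1 : flip b p |: rich e 1 X \subset rich e' 1 X.
  apply/subsetP=> q /setU1P[->|]; rewrite !inE; last first.
    case: (eqVneq q p) => [->|qp] g; first by rewrite cl_swap_p.
    by apply: leq_trans g _; rewrite subset_leq_card // cl_swap_sub.
  case/set0Pn: dn => z zd; move: f0; rewrite inE card_gt0 => /set0Pn[w wf].
  apply/card_gt1P; exists z, w; rewrite (subsetP dst_sub_swap) //.
  rewrite (subsetP (cl_swap_sub (flip_neq b p))) //; split=> //.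
  apply: contraTneq wf => <-; apply/negP => /clP[_]; case/clP: (dp z zd) => _ -> /eqP.
  by rewrite eq_sym (negPf (flip_neq b p)).
have le1 : #|rich e' 1 X| <= #|rich e 1 X|.
  by rewrite card_rich_swap O3 ?ct // -card_rich_swap.
have f1 : flip b p \in rich e 1 X.
  apply: contraT => N; have := subset_leq_card sub1.
  by rewrite cardsU1 N add1n ltnNge le1.
split; last by move: f1; rewrite inE.
split=> // [Z|Z cZ|Z cZ kZ].
- by move=> cZ; rewrite card_rich_swap -(ct Z) O1 ?ct.
- by rewrite card_rich_swap O1' ?ct.
- rewrite card_rich_swap; apply: leq_trans (O3 _ _ _) _; rewrite ?ct -?card_rich_swap //.
  by apply: subset_leq_card; apply: subset_trans sub1; apply: subsetU1.
Qed.

(** By the uniqueness of links, a1 and b1 differ from a and b, so the vertices distinguishing them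
    do not change, and the class q loses nothing. *)
Lemma link_swap a1 b1 q : 1 < #|cl e X (flip b p)| -> q != p -> link e X a1 b1 q ->
  [/\ b1 != b, dst e' a1 b1 = dst e a1 b1 & link e' X a1 b1 q].
Proof.
move=> gf qp L; have gq := link_gt1 L; have gp := link_gt1 lk.
have bb : b1 != b.
  by apply: contra qp => /eqP E; rewrite E in L; have [_ ->] := link_label es lk L.
have aa : a1 != a.
  by apply: contra qp => /eqP E; rewrite E in L; rewrite (link_fst lk L).
case/and5P: (lk) => aX sa bX dn /andP[/subsetP dp _].
case/and5P: (L) => a1X sa1 b1X dn1 /andP[/subsetP dq Aq].
have a1b : a1 != b by apply: contraNneq a1X => ->.
have b1a : b1 != a by apply: contraNneq aX => <-.
have dE : dst e' a1 b1 = dst e a1 b1.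
  have [na nb] : a \notin dst e a1 b1 /\ b \notin dst e a1 b1.
    split; apply/negP=> /dq; last by move/cl_notin; rewrite bX.
    by move/(single_neq sa aX gq); rewrite eqxx.
  have [E1 E2] : tperm a b a1 = a1 /\ tperm a b b1 = b1 by rewrite !tpermD 1?eq_sym.
  apply/setP=> z; case: (eqVneq z a) => [->|za].
    rewrite (negPf na) inE /e' /swap E1 E2 tpermL.
    by move: nb; rewrite inE [b == a1]eq_sym a1b [b == b1]eq_sym bb /= => /negPf->; rewrite !andbF.
  case: (eqVneq z b) => [->|zb].
    rewrite (negPf nb) inE /e' /swap E1 E2 tpermR.
    by move: na; rewrite inE [a == a1]eq_sym aa [a == b1]eq_sym b1a /= => /negPf->; rewrite !andbF.
  by rewrite !inE /e' /swap E1 E2 tpermD 1?eq_sym.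
split=> //; have a1d : a1 \notin d.
  by apply/negP=> /dp/(single_neq sa1 a1X gp); rewrite eqxx.
rewrite /link a1X pat_swap // (negPf a1d) cl_swap_eq ?sa1 ?b1X ?dE ?dn1 /=; last 2 first.
- by apply: contraTneq sa1 => ->; rewrite -ltnNge.
- by apply: contraTneq sa1 => ->; rewrite -ltnNge.
have sq := cl_swap_sub qp; apply/andP; split.
  by apply: subset_trans sq; apply/subsetP.
case/set0Pn: Aq => w /setDP[wq wd]; apply/set0Pn; exists w.
by rewrite inE wd (subsetP sq).
Qed.

End OneSwap.

(** * Chains of links between classes *)

Definition step e X : rel {set T} :=
  [rel p q | [exists a, exists b, link e X a b p && (q == flip b p)]].

Lemma stepP e X p q : reflect (exists a b, link e X a b p /\ q = flip b p) (step e X p q).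
Proof.
apply: (iffP existsP) => -[a]; first by case/existsP=> b /andP[L /eqP->]; exists a, b.
by case=> b [L ->]; exists a; apply/existsP; exists b; rewrite L eqxx.
Qed.

(* The bit [b] is flipped only when the path leaves the class [p], so the path never returns to [p]. *)
Lemma path_swap e X a b p s q : symmetric e -> link e X a b p ->
  1 < #|cl e X (flip b p)| -> (b \in q) != (b \in p) ->
  path (step e X) q s -> #|cl e X (last q s)| <= 1 ->
  path (step (swap e a b) X) q s /\ #|cl (swap e a b) X (last q s)| <= 1.
Proof.
move=> es lk gf; elim: s q => [|q' s IH] q bq /=; have qp : q != p by apply: contraNneq bq => ->.
  by move=> _ c; rewrite (cl_swap_eq es lk) //; apply: contraTneq c => ->; rewrite -ltnNge.
case/andP=> /stepP[a1 [b1 [L ->]]] ps cs.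
have [bb _ L'] := link_swap es lk gf qp L.
have [|] := IH (flip b1 q) _ ps cs; first by rewrite mem_flip [b == b1]eq_sym (negPf bb) addbF.
move=> -> ->; rewrite andbT; split=> //; apply/stepP; by exists a1, b1.
Qed.

(* Swapping the links of the path one after the other moves vertices along it; in the end
   there is one more class with at least two elements, against the choice of [X]. *)
Lemma no_reach X s e p a b : symmetric e -> opt e X -> link e X a b p ->
  1 < #|cl e X p :\: dst e a b| -> path (step e X) (flip b p) s ->
  1 < #|cl e X (last (flip b p) s)|.
Proof.
elim: s e p a b => [|q s IH] e p a b es O lk st /=; first by have [] := opt_swap es lk st O.
case/andP=> /stepP[a1 [b1 [L ->]]] ps; rewrite ltnNge; apply/negP => cs.
have [O' gf] := opt_swap es lk st O.
have [bb dE L'] := link_swap es lk gf (flip_neq b p) L.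
have [|ps' cs'] := path_swap es lk gf _ ps cs.
  by rewrite !mem_flip eqxx [b == b1]eq_sym (negPf bb); case: (b \in p).
(* The next exchange is strong again: its class keeps w, which the second link leaves behind, and
   has gained z, moved from p and not in [dst e a1 b1]. *)
suff st' : 1 < #|cl (swap e a b) X (flip b p) :\: dst (swap e a b) a1 b1|.
  by have := IH _ _ _ _ (swap_sym a b es) O' L' st' ps'; rewrite ltnNge cs'.
rewrite dE; case/and5P: (lk) => aX sa bX /set0Pn[z zd] /andP[/subsetP dp _].
case/and5P: (L) => _ _ _ _ /andP[/subsetP dq /set0Pn[w /setDP[wq wd]]].
have zf : z \notin cl e X (flip b p).
  apply/negP => /clP[_]; case/clP: (dp z zd) => _ -> /eqP.
  by rewrite eq_sym (negPf (flip_neq b p)).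
apply/card_gt1P; exists z, w; rewrite !in_setD wd (subsetP (dst_sub_swap es lk)) //.
rewrite (subsetP (cl_swap_sub es lk (flip_neq b p))) // andbT; split=> //.
  by apply: contra zf => /dq.
by apply: contraNneq zf => ->.
Qed.

End Swap.

(** * Extremal sets *)

Section Main.
Variables (T : finType) (e : rel T).
Hypothesis es : symmetric e.
Implicit Types (Z X Y D P p q : {set T}) (a b u v x y z : T).

Lemma all_single_inj Z :
  (forall v, v \notin Z -> #|cl e Z (pat e Z v)| <= 1) -> {in ~: Z &, injective (pat e Z)}.
Proof.
move=> H u v; rewrite !inE => uZ vZ E; apply/eqP; apply: contraT => uv.
move: (H u uZ); rewrite leqNgt => /negP[].
by apply/card_gt1P; exists u, v; rewrite mem_cl // E mem_cl.
Qed.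

(** A vertex of a nonsingleton class could be added without losing a pattern, which the surplus
    allows but maximality forbids. So all classes are singletons. *)
Lemma surplus_sep Z : #|Z| < #|rich e 0 Z| ->
  (forall Z', #|Z| < #|Z'| -> #|rich e 0 Z'| < #|Z'|) ->
  exists2 Y, sep e Y & #|T| < 2 * #|Y|.
Proof.
move=> kZ O1; have inj : {in ~: Z &, injective (pat e Z)}.
  apply: all_single_inj => v vZ; have := card_rich_add es vZ.
  have := O1 (v |: Z); rewrite cardsU1 vZ add1n => /(_ (ltnSn _)).
  by case: (_ <= 1) => //; card_lia.
exists (~: Z); first exact: sep_pat inj.
by have := cardsC Z; move: kZ; rewrite rich0E card_in_imset //; card_lia.
Qed.

Lemma opt_exists : (exists X, opt e X) \/ exists2 Y, sep e Y & #|T| < 2 * #|Y|.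
Proof.
pose P0 Z := #|Z| <= #|rich e 0 Z|.
have g0 : P0 set0 by rewrite /P0 cards0.
case: (arg_maxnP (fun Z : {set T} => #|Z|) g0) => X kX Xmax.
have O1 Z : #|X| < #|Z| -> #|rich e 0 Z| < #|Z|.
  by move=> XZ; rewrite ltnNge; apply/negP => /Xmax /=; card_lia.
case: (pickP (fun Z => (#|Z| == #|X|) && (#|X| < #|rich e 0 Z|))) => [Z /andP[/eqP cZ kZ]|N].
  by right; apply: (@surplus_sep Z); rewrite cZ.
have O1' Z : #|Z| = #|X| -> #|rich e 0 Z| <= #|X|.
  by move=> cZ; move: (N Z); rewrite cZ eqxx /= => h; rewrite leqNgt h.
left; pose P1 Z := (#|Z| == #|X|) && (#|rich e 0 Z| == #|X|).
have gX : P1 X by rewrite /P1 eqxx eqn_leq O1'.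
case: (arg_maxnP (fun Z : {set T} => #|rich e 1 Z|) gX) => X1 /andP[/eqP c1 /eqP k1] m1.
exists X1; split; rewrite ?c1 // => Z cZ kZ; apply: m1.
by rewrite /P1 cZ kZ !eqxx.
Qed.

Hypothesis tf : forall a b, a != b -> dst e a b != set0.

(** * The three separated sets of an optimal set *)

Section Optimal.
Variable X : {set T}.
Hypothesis O : opt e X.

Let C := [set v | (v \notin X) && (1 < #|cl e X (pat e X v)|)].

Lemma opt_add v : v \notin X -> #|rich e 0 (v |: X)| <= #|rich e 0 X|.
Proof.
by move=> vX; case: O => O1 _ -> _; have := O1 (v |: X); rewrite cardsU1 vX; card_lia.
Qed.

Lemma dst_sym a b : dst e a b = dst e b a.
Proof. by apply/setP=> z; rewrite !inE andbCA [e z a == _]eq_sym. Qed.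

Lemma nonsingle_uniform z p u v : z \in C -> u \in cl e X p -> v \in cl e X p ->
  u != z -> v != z -> e u z = e v z.
Proof.
rewrite inE => /andP[zX g] uc vc uz vz; rewrite ![e _ z]es.
exact: (nonsingle_no_split es zX (opt_add zX) g uc vc).
Qed.

(** Two vertices of one class are distinguished by some z, and z is not in [C] because vertices of
    [C] split no class. *)
Lemma sep_nonsingle : sep e C.
Proof.
move=> u v; rewrite !inE => /andP[uX _] /andP[vX _] uv.
case: (eqVneq (pat e X u) (pat e X v)) => [E|/pat_neq[x xX N]]; last first.
  by exists x; rewrite ?inE ?xX // ![e x _]es.
have /set0Pn[z] := tf uv; rewrite inE => /and3P[zu zv N]; exists z => //.
apply: contra N => zC; apply/eqP; rewrite ![e z _]es.
by apply: (@nonsingle_uniform _ (pat e X u)); rewrite ?mem_cl // 1?eq_sym // E mem_cl.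
Qed.

Lemma card_opt : #|T| + #|rich e 1 X| = 2 * #|X| + #|C|.
Proof.
pose S := ~: X :\: C; case: O => _ _ O2 _.
have SP v : v \in S -> v \notin X /\ #|cl e X (pat e X v)| <= 1.
  by rewrite !inE => /andP[]; case: (v \in X) => //=; rewrite -leqNgt.
have sub : rich e 1 X \subset rich e 0 X by apply/subsetP => p; rewrite !inE; card_lia.
have inj : {in S &, injective (pat e X)}.
  move=> u v /SP[uX c] /SP[vX _] E; apply/eqP; apply: contraT => uv.
  move: c; rewrite leqNgt => /negP[].
  by apply/card_gt1P; exists u, v; rewrite mem_cl // E mem_cl.
have cS : #|S| = #|rich e 0 X :\: rich e 1 X|.
  rewrite -(card_in_imset inj); apply: eq_card => p; rewrite in_setD rich0E.
  apply/imsetP/andP => [[v /SP[vX c] ->]|[np /imsetP[v]]].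
    by rewrite inE -leqNgt c; split=> //; apply/imsetP; exists v; rewrite ?inE.
  rewrite inE => vX E; exists v => //; move: np; rewrite E !inE vX /= => ->.
  by [].
have := cardsC X; have := cardsID C (~: X); rewrite -/S cS.
have := cardsID (rich e 1 X) (rich e 0 X); rewrite (setIidPr sub) O2.
have -> : ~: X :&: C = C by apply/setIidPr/subsetP=> v; rewrite !inE => /andP[].
card_lia.
Qed.

Let reach p := [exists q, connect (step e X) p q && (#|cl e X q| <= 1)].

Lemma reach_link a b p : link e X a b p -> reach (flip b p) -> reach p.
Proof.
move=> L /existsP[q /andP[c g]]; apply/existsP; exists q; rewrite g andbT.
by apply: connect_trans c; apply/connect1/stepP; exists a, b.
Qed.

Lemma reach_strong a b p : link e X a b p -> 1 < #|cl e X p :\: dst e a b| ->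
  ~~ reach (flip b p).
Proof.
move=> L g; apply/existsP => -[q /andP[/connectP[s ps ->]]].
by rewrite leqNgt (no_reach es O L g ps).
Qed.

Lemma reach_gt1 p : ~~ reach p -> 1 < #|cl e X p|.
Proof.
by rewrite ltnNge; apply: contra => c; apply/existsP; exists p; rewrite connect0.
Qed.

(* If [p] reaches a class of size at most 1, two of its vertices are left free; otherwise one vertex
   is put in the complement ([Q]). Both choices cost the same in the final count. *)
Let R p := [set x in take (reach p).+1 (enum (cl e X p))].
Let D := [set v in C | v \notin R (pat e X v)].
Let Q := [set v in C | (v \in R (pat e X v)) && ~~ reach (pat e X v)].

Lemma R_sub p : R p \subset cl e X p.
Proof. by apply/subsetP=> x; rewrite inE => /mem_take; rewrite mem_enum. Qed.

Lemma R_card p : 1 < #|cl e X p| -> #|R p| = (reach p).+1.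
Proof.
move=> g; rewrite cardsE (card_uniqP _) ?take_uniq ?enum_uniq // size_take -cardE.
by case: (reach p); case: ltnP => //; card_lia.
Qed.

Lemma mem_C p v : 1 < #|cl e X p| -> v \in cl e X p -> v \in C.
Proof. by move=> g /clP[vX E]; rewrite inE vX E. Qed.

Lemma card_classes (A : {set T}) : A \subset C -> #|A| = \sum_(p in rich e 1 X) #|cl e X p :&: A|.
Proof.
move=> AC; rewrite -sum1_card (partition_big (pat e X) (mem (rich e 1 X))) /=.
  apply: eq_bigr => p _; rewrite -sum1_card; apply: eq_bigl => v.
  rewrite !inE andbC; case: (boolP (v \in A)) => vA; rewrite ?andbF //.
  by have := subsetP AC v vA; rewrite inE => /andP[->].
by move=> v /(subsetP AC); rewrite !inE => /andP[].
Qed.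

Lemma class_CDQ p : p \in rich e 1 X ->
  [/\ cl e X p :&: C = cl e X p, cl e X p :&: D = cl e X p :\: R p &
      cl e X p :&: Q = if reach p then set0 else R p].
Proof.
rewrite inE => g; split; apply/setP=> v; rewrite in_setI.
- by case: (boolP (v \in cl e X p)) => //= /(mem_C g).
- rewrite in_setD; case: (boolP (v \in cl e X p)) => vp; rewrite ?andbF //= andbT.
  by rewrite inE (mem_C g vp); case/clP: vp => _ ->.
- case: (boolP (v \in cl e X p)) => vp /=.
    rewrite inE (mem_C g vp); case/clP: vp => _ ->.
    by case: (reach p); rewrite ?inE ?andbF ?andbT.
  case: (reach p); rewrite ?inE //; apply/esym/negP => vR.
  by case/negP: vp; apply: (subsetP (R_sub p)); rewrite inE.
Qed.

(** A class that reaches a small one gives all but two vertices to [D] and none to [Q]; any other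
    gives all but one to [D] and one to [Q]. Either way it adds its size minus 2 to |D| - |Q|. *)
Lemma card_D : #|D| + 2 * #|rich e 1 X| = #|C| + #|Q| /\ #|Q| <= #|D|.
Proof.
have sD : D \subset C by apply/subsetP=> v; rewrite inE => /andP[].
have sQ : Q \subset C by apply/subsetP=> v; rewrite inE => /andP[].
have c p : p \in rich e 1 X -> #|cl e X p :&: D| + 2 = #|cl e X p :&: C| + #|cl e X p :&: Q|
    /\ #|cl e X p :&: Q| <= #|cl e X p :&: D|.
  move=> pB; have [-> -> ->] := class_CDQ pB; move: pB; rewrite inE => g.
  have := cardsID (R p) (cl e X p); rewrite (setIidPr (R_sub p)) R_card //.
  by case: (reach p) (R_card g) => /= cR; rewrite ?cards0 ?cR; card_lia.
rewrite !card_classes // mulnC -sum_nat_const -!big_split /=; split.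
  by apply: eq_bigr => p /c[].
by apply: leq_sum => p /c[].
Qed.

Lemma D_C v : v \in D -> v \in C.
Proof. by rewrite inE => /andP[]. Qed.

Lemma D_X v : v \in D -> v \notin X.
Proof. by move/D_C; rewrite inE => /andP[]. Qed.

Lemma R_D p r : r \in R p -> r \notin D.
Proof.
move=> rR; rewrite inE; have /clP[_ E] := subsetP (R_sub p) r rR.
by rewrite E rR andbF.
Qed.

Lemma nonreach_D p : ~~ reach p -> exists2 v, v \in D & v \in cl e X p.
Proof.
move=> np; have g := reach_gt1 np.
have := cardsID (R p) (cl e X p); rewrite (setIidPr (R_sub p)) R_card // (negPf np) => E.
have /card_gt0P[v /setDP[vp vR]] : 0 < #|cl e X p :\: R p| by card_lia.
by exists v => //; rewrite inE (mem_C g vp); case/clP: vp => _ ->.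
Qed.

(** Suppose only vertices of [D] distinguish a and b. Vertices of [R] do not, so comparing z with
    one of them in its class rules out all cases but b in X and a alone in its class. Then a splits
    the class of every vertex in [dst e a b]; it splits at most one, so a and b form a link. *)
Lemma dst_out (B P : {set T}) : [disjoint P & D] -> Q \subset B -> P \subset B ->
  (forall u v, u \in D -> v \in D -> pat e X u != pat e X v ->
     exists2 x, x \in P :&: X & e u x != e v x) ->
  forall a b, a \notin B -> b \notin B -> a != b -> exists2 z, z \notin D & z \in dst e a b.
Proof.
move=> dPD QB PB distP a b aB bB ab.
case: (pickP (fun z => (z \notin D) && (z \in dst e a b))) => [z /andP[]|N]; first by exists z.
have {}N z : z \in dst e a b -> z \in D.
  by move=> zd; move: (N z); rewrite zd andbT => /negbFE.
exfalso.
wlog bX : a b aB bB ab N / (b \in X) || (a \notin X).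
  move=> H; case: (boolP (a \in X)) => aX; last by apply: (H a b) => //; rewrite aX orbT.
  by apply: (H b a); rewrite ?aX // 1?eq_sym // dst_sym.
have /set0Pn[z zd] := tf ab.
have zD := N z zd; have zX := D_X zD; have zC := D_C zD.
pose p := pat e X z; have zp : z \in cl e X p by apply: mem_cl.
have g : 1 < #|cl e X p| by move: zC; rewrite inE => /andP[].
have [za zb zN] : [/\ z != a, z != b & e z a != e z b].
  by move: zd; rewrite inE => /and3P[].
have R_agree q r : r \in R q -> r != a -> r != b -> e r a = e r b.
  by move=> rR ra rb; apply: dst_eq => //; apply: contra (R_D rR) => /N.
have cX u q y : u \in cl e X q -> y \in X -> u != y.
  by move=> /cl_notin uX yX; apply: contraNneq uX => ->.
have cXE u v q y : u \in cl e X q -> v \in cl e X q -> y \in X -> e u y = e v y.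
  by move=> uq vq yX; rewrite (pat_mem uq yX) (pat_mem vq yX).
have Rcl r q : r \in R q -> r \in cl e X q by apply: (subsetP (R_sub q)).
have [r0 r0R] : exists r, r \in R p.
  by apply/card_gt0P; rewrite R_card.
case: (boolP (b \in X)) bX => /= bX; last first.
  move=> aX; case: (eqVneq (pat e X a) (pat e X b)) => [E|/pat_neq[x xX xN]].
    case/eqP: zN; rewrite ![e z _]es.
    by apply: (@nonsingle_uniform _ (pat e X a)); rewrite ?mem_cl // 1?eq_sym // E mem_cl.
  have xd : x \in dst e a b.
    by rewrite inE ![e x _]es xN andbT; apply/andP; split; [apply: contraNneq aX|apply: contraNneq bX] => <-.
  by move: (D_X (N x xd)); rewrite xX.
move=> _; case: (boolP (a \in X)) => aX.
  have r0p := Rcl _ _ r0R; case/eqP: zN.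
  rewrite (cXE z r0 p a) // (cXE z r0 p b) //.
  by apply: (R_agree _ _ r0R); apply: (cX _ _ _ r0p).
case: (boolP (a \in C)) => aC.
  (* If p reaches a small class, [R p] has two elements to choose from; otherwise its only element
     is in [Q], hence in B, and is not a. *)
  have [r rR ra] : exists2 r, r \in R p & r != a.
    case: (boolP (reach p)) => rp; last first.
      exists r0 => //; apply: contraNneq aB => <-; apply: (subsetP QB).
      have r0p := Rcl _ _ r0R; rewrite inE (mem_C g r0p).
      by case/clP: (r0p) => _ ->; rewrite r0R.
    have /card_gt1P[r1 [r2 [r1R r2R r12]]] : 1 < #|R p| by rewrite R_card // rp.
    case: (eqVneq r1 a) => [E|]; last by exists r1.
    by exists r2; rewrite // -E eq_sym.
  have rp := Rcl _ _ rR; case/eqP: zN.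
  rewrite (nonsingle_uniform aC zp rp) // (cXE z r p b) //.
  by apply: R_agree rR _ _; rewrite // (cX r p b).
have sa : #|cl e X (pat e X a)| <= 1 by move: aC; rewrite inE aX /= -leqNgt.
have ca u q : 1 < #|cl e X q| -> u \in cl e X q -> u != a.
  by move=> gq uq; apply: single_neq gq uq.
have splita y : y \in dst e a b -> exists w, let q := pat e X y in
  [/\ w \in cl e X q, w != a, y \in cl e X q, y != a & e a w != e a y].
  move=> yd; have yD := N y yd; have yX := D_X yD; have yC := D_C yD.
  have gy : 1 < #|cl e X (pat e X y)| by move: yC; rewrite inE => /andP[].
  have yc := mem_cl e yX.
  have /card_gt0P[w wR] : 0 < #|R (pat e X y)| by rewrite R_card.
  have wc := Rcl _ _ wR; have wa := ca _ _ gy wc; have ya := ca _ _ gy yc.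
  exists w; split=> //; move: yd; rewrite inE => /and3P[_ yb]; apply: contra => /eqP E.
  rewrite es -E es (R_agree _ _ wR) ?(cX w (pat e X y) b) //.
  by rewrite (cXE w y (pat e X y) b).
have dp : dst e a b \subset cl e X p.
  apply/subsetP=> y yd; have [w [wc wa yc ya yN]] := splita y yd.
  have [w' [wc' wa' zc' _ zN']] := splita z zd.
  have -> : p = pat e X y; last by [].
  exact: (split_unique es aX (opt_add aX) wc' zc' wa' za zN' wc yc wa ya yN).
have Rp : R p \subset cl e X p :\: dst e a b.
  by apply/subsetP=> r rR; rewrite in_setD (Rcl _ _ rR) andbT; apply: contra (R_D rR) => /N.
have L : link e X a b p.
  rewrite /link aX sa bX dp -!card_gt0 /=; apply/andP; split; first by apply/card_gt0P; exists z.
  by apply: leq_trans (subset_leq_card Rp); rewrite R_card.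
(* If p reaches a small class, the two vertices of [R p] make the exchange strong; if not, neither
   does its successor. *)
have nf : ~~ reach (flip b p).
  case: (boolP (reach p)) => rp; last by apply: contra rp; apply: reach_link L.
  by apply: (reach_strong L); apply: leq_trans (subset_leq_card Rp); rewrite R_card // rp.
(* The patterns of v and z differ only in the bit b, so distinguishing them within P would need b in
   P. *)
have [v vD vf] := nonreach_D nf; case/clP: (vf) => _ vE.
have [|x /setIP[xP xX] xN] := distP z v zD vD.
  by rewrite vE -/p eq_sym flip_neq.
have xb : x != b by apply: contraNneq bB => <-; apply: (subsetP PB).
by case/eqP: xN; rewrite (pat_mem zp xX) (pat_mem vf xX) mem_flip (negPf xb) addbF.
Qed.

Lemma opt_sep : 0 < #|T| -> exists2 Y, sep e Y & 3 * #|T| < 8 * #|Y|.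
Proof.
move=> T0; have [cD QD] := card_D; have cT := card_opt.
have cX : #|rich e 0 X| = #|X| by case: O.
have [Y1 sY1] := transversal_sep es X; rewrite cX => cY1.
have sC := sep_nonsingle.
(* The weights 1, 3 and 4 add up to 8. *)
have fin Y2 : sep e Y2 -> 3 * #|T| < #|C| + 3 * #|Y2| + 4 * #|Y1| ->
    exists2 Y, sep e Y & 3 * #|T| < 8 * #|Y|.
  move=> sY2 lt; case: (leqP (3 * #|T|).+1 (8 * #|C|)) => h1; first by exists C.
  case: (leqP (3 * #|T|).+1 (8 * #|Y1|)) => h2; first by exists Y1.
  by exists Y2 => //; card_lia.
(* The Bondy argument needs a vertex in [D]. Without one, |C| = 2m and n = 2w + m, and the larger of
   [C] and [Y1] serves. *)
case: (posnP #|D|) => D0.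
  case: (leqP #|C| #|Y1|) => h; [apply: (fin Y1 sY1)|apply: (fin C sC)]; card_lia.
have [v0 v0D] : exists v, v \in D by apply/card_gt0P.
have k0 : #|@set0 T| < #|pat e set0 @: D|.
  by rewrite cards0; apply/card_gt0P; exists (pat e set0 v0); apply: imset_f.
(* [P1] distinguishes vertices of [D] as well as X does. Vertices of [D] that agree on [P2] thus lie
   in one class; no vertex outside [D] distinguishes them by the choice of [P2], and those in [D]
   split no class. *)
have [P1 [_ P1X kP1 P1E]] := grow_patterns X k0.
have [P2 [P12 P2D kP2 P2E]] := grow_patterns (~: D) kP1.
rewrite set0U in P1X.
have injP2 : {in D &, injective (pat e P2)}.
  move=> u v uD vD E; apply/eqP; apply: contraT => uv.
  have EX : pat e X u = pat e X v.
    by apply/eqP/patP => x; apply: (P1E u v x uD vD (pat_subset P12 E)).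
  have /set0Pn[z] := tf uv; rewrite inE ![e z _]es => /and3P[zu zv].
  case: (boolP (z \in D)) => zD; last by rewrite (P2E u v z uD vD E) ?eqxx // inE.
  rewrite (@nonsingle_uniform z (pat e X u) u v) ?eqxx ?(D_C zD) // 1?eq_sym //.
    by rewrite mem_cl ?D_X.
  by rewrite EX mem_cl ?D_X.
have dP2 : [disjoint P2 & D].
  rewrite disjoints_subset; apply: subset_trans P2D _; rewrite subUset subxx andbT.
  by apply: subset_trans P1X _; apply/subsetP=> x xX; rewrite inE; apply: contraL xX => /D_X.
have dQ : [disjoint P2 :|: Q & D].
  rewrite disjoints_subset subUset -!disjoints_subset dP2 disjoints_subset.
  by apply/subsetP=> v; rewrite inE in_setC => /and3P[_ vR _]; exact: R_D vR.
have injB : {in D &, injective (pat e (P2 :|: Q))}.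
  by move=> u v uD vD /(pat_subset (subsetUl _ _)); apply: injP2.
have distP u v : u \in D -> v \in D -> pat e X u != pat e X v ->
    exists2 x, x \in P2 :&: X & e u x != e v x.
  move=> uD vD N; have [|x xP xN] := @pat_neq _ e P1 u v.
    by apply: contra_neq N => E; apply/eqP/patP => x; apply: P1E E.
  by exists x; rewrite // inE (subsetP P12) ?(subsetP P1X).
have [Y2 sY2 cY2] :=
  relative_sep es dQ injB (dst_out dP2 (subsetUr _ _) (subsetUl _ _) distP).
have cP2 : #|P2| < #|D| by apply: leq_trans kP2 (leq_imset_card _ _).
(* As |P2| < |D|, 3|Y2| >= n + |D| - |Q| + 1; [card_D] gives |D| - |Q| = |C| - 2m, and [card_opt]
   eliminates m. *)
have cU := cardsU P2 Q; apply: (fin Y2 sY2); card_lia.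
Qed.

End Optimal.

Lemma exists_sep : 0 < #|T| -> exists2 Y, sep e Y & 3 * #|T| < 8 * #|Y|.
Proof.
move=> T0; case: opt_exists => [[X O]|[Y sY lt]]; first exact: (opt_sep O).
by exists Y => //; card_lia.
Qed.

End Main.

(** * From separated sets to locating-dominating sets *)

Lemma twin_free_dst (T : finType) (e : rel T) a b :
  symmetric e -> irreflexive e -> twin_free e -> a != b -> dst e a b != set0.
Proof.
move=> es ei tf ab; apply/eqP => /setP d0; case: (tf a b); split=> //.
apply/setP=> z; move: (d0 z); rewrite !inE ![e z _]es.
case: (eqVneq z a) => [->|za]; first by rewrite ei andbF.
case: (eqVneq z b) => [->|zb]; first by rewrite ei.
by move=> /negbFE/eqP.
Qed.

Lemma LD_le (T : finType) (e : rel T) (X : {set T}) : locating_dominating e X -> LD e <= #|X|.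
Proof.
move=> lX; rewrite /LD; have := mem_index_enum X; elim: (index_enum _) => // Z r IH.
rewrite inE big_cons => /orP[/eqP<-|/IH le]; first by rewrite lX geq_minl.
by case: ifP => // _; apply: leq_trans (geq_minr _ _) le.
Qed.

(* At most one vertex of [Y] has no neighbour outside [Y]; it is moved to the complement. *)
Lemma sep_LD (T : finType) (e : rel T) (Y : {set T}) : symmetric e ->
  sep e Y -> LD e <= (#|T| - #|Y|).+1.
Proof.
move=> es sY; pose f v := nbhd e v :&: ~: Y.
have loc (X : {set T}) : ~: Y \subset X -> locating e X.
  move=> YX; apply/forallP => u; apply/forallP => v; apply/implyP => /andP[/andP[uX vX] uv].
  have inY w : w \notin X -> w \in Y.
    by apply: contraR => wY; apply: (subsetP YX); rewrite inE.
  have [z zY] := sY u v (inY u uX) (inY v vX) uv.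
  rewrite /distinguishes uX vX; apply: contra => /eqP/setP/(_ z); rewrite !inE ![e z _]es.
  by rewrite (subsetP YX) ?inE // !andbT => ->.
have cY : #|~: Y| = #|T| - #|Y| by rewrite -(cardsC Y) addKn.
case: (pickP (fun v => (v \in Y) && (f v == set0))) => [v /andP[vY /eqP fv]|N].
  apply: leq_trans (_ : #|v |: ~: Y| <= _); last first.
    by rewrite cardsU1 inE vY cY.
  apply: LD_le; rewrite /locating_dominating loc ?subsetU1 //.
  apply/forallP => u; apply/implyP; rewrite !inE negb_or negbK => /andP[uv uY].
  have [z zY zN] := sY u v uY vY uv.
  have zv : z \notin nbhd e v by move/setP: fv => /(_ z); rewrite !inE zY andbT => ->.
  apply/set0Pn; exists z; move: zN zv; rewrite !inE zY orbT andbT ![e z _]es.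
  by case: (e u z) (e v z) => [] [].
apply: leq_trans (leqnSn _); rewrite -cY; apply: LD_le.
rewrite /locating_dominating loc //; apply/forallP => u; apply/implyP.
by rewrite inE negbK => uY; move: (N u); rewrite uY /= => ->.
Qed.

(* ceil(5n/8) = (5n + 7) %/ 8 *)
Theorem theorem1 (T : finType) (e : rel T) :
  simple_graph e -> twin_free e -> LD e <= (5 * #|T| + 7) %/ 8.
Proof.
move=> [es ei] tf; case: (posnP #|T|) => T0.
  apply: leq_trans (_ : #|@set0 T| <= _); last by rewrite cards0.
  apply: LD_le; apply/andP; split; apply/forallP => v;
  by have := card0_eq T0 v.
have [Y sY lt] := exists_sep es (fun a b => twin_free_dst es ei tf) T0.
(* The strict inequality 3n < 8|Y| absorbs the extra vertex: 8(n - |Y| + 1) <= 5n + 7. *)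
apply: leq_trans (sep_LD es sY) _; rewrite leq_divRL //.
by have := max_card [in Y]; card_lia.
Qed.
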